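(* Let $(B,\cdot,\circ)$ be a completely simple left semi-brace such that the associated $\rho$-map is an anti-homomorphism. The ideals of $B$ are precisely the kernels of left semi-brace homomorphisms with domain $B$.
   Context: A left semi-brace is a set $B$ with two operations $\cdot$ and $\circ$ such that $(B,\cdot)$ is a semigroup, $(B,\circ)$ is a group, and $a\circ(bc)=(a\circ b)(a\circ(\overline{a}c))$ for all $a,b,c\in B$ (here $xy$ means $x\cdot y$ and $\overline{a}$ is the inverse of $a$ in $(B,\circ)$). The identity of $(B,\circ)$ is $1_{\circ}$. It is completely simple if $(B,\cdot)$ is. $1_{\circ}B=\{1_{\circ}b\mid b\in B\}$, $B1_{\circ}=\{b1_{\circ}\mid b\in B\}$, and $G=1_{\circ}B1_{\circ}=\{1_{\circ}b1_{\circ}\mid b\in B\}$, which is a group under $\cdot$ when $B$ is completely simple. Maps: $\lambda_a(b)=a\circ(\overline{a}b)$ and $\rho_a(b)=\overline{(\overline{b}a)}\circ a$ for $a,b\in B$. $\rho:a\mapsto\rho_a$ is an anti-homomorphism if $\rho_{a\circ b}=\rho_b\rho_a$ (composition of maps) for all $a,b\in B$. Ideal: a subsemigroup $I$ of $(B,\cdot)$ such that (1) $(I\cap G,\cdot)$ is a normal subgroup of $(G,\cdot)$; (2) $(I,\circ)$ is a normal subgroup of $(B,\circ)$; (3) $\rho_b(I)\subseteq I$ for all $b\in 1_{\circ}B$; (4) $\lambda_a(I)\subseteq I$ for all $a\in B1_{\circ}$. A left semi-brace homomorphism $f:B\to B_1$ is a map between left semi-braces respecting both $\cdot$ and $\circ$;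 its kernel is $\ker f=\{a\in B\mid f(a)=1_{\circ}\}$. *)

(* Defs.v *)
From HB Require Import structures.
From mathcomp Require Import all_boot.
From mathcomp Require Import boolp classical_sets.

Set Implicit Arguments.
Unset Strict Implicit.
Unset Printing Implicit Defensive.

Local Open Scope group_scope.
Local Open Scope classical_set_scope.

Reserved Notation "x · y" (at level 40, left associativity).

(* The library's group operation [x * y], with unit [1] and inverse [x^-1], is
   the operation "circ" of the semi-brace; the semigroup operation is [x · y].
   Pitfall: [groupType] also carries a choice operator on the carrier; by the
   classical axioms of [boolp] every type has one, so this excludes no group. *)
HB.mixin Record Group_isLeftSemiBrace B of Group B := {
  sdot : B -> B -> B;
  sdotA : associative sdot;
  mulg_sdot : forall a b c : B,
    a * sdot b c = sdot (a * b) (a * sdot a^-1 c)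
}.

#[short(type="leftSemiBraceType")]
HB.structure Definition LeftSemiBrace :=
  {B of Group_isLeftSemiBrace B & Group B}.

Notation "x · y" := (sdot x y) : group_scope.

Section OperationOnSets.
Variables (T : Type) (op : T -> T -> T).
Implicit Types S N J : set T.

Definition closed_under_op S := forall x y, S x -> S y -> S (op x y).

Definition is_subsemigroup S := S !=set0 /\ closed_under_op S.

Definition is_identity_of S e :=
  S e /\ forall x, S x -> op e x = x /\ op x e = x.

(* The identity is intrinsic to [S], as [op] need not have an identity on the
   whole of [T]. *)
Definition is_group S :=
  [/\ closed_under_op S,
      forall x y z, S x -> S y -> S z -> op x (op y z) = op (op x y) z
    & exists2 e, is_identity_of S e &
        forall x, S x -> exists2 y, S y & op x y = e /\ op y x = e].

(* Here [h] ranges over the inverses of [g] in the group [S]. *)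
Definition is_normal_subgroup N S :=
  [/\ is_group S, N `<=` S, is_group N
    & forall e g h n, is_identity_of S e -> S g -> S h ->
        op g h = e -> op h g = e -> N n -> N (op (op g n) h)].

Definition is_semigroup_ideal J :=
  J !=set0 /\ forall x y, J y -> J (op x y) /\ J (op y x).

Definition is_idempotent e := op e e = e.

Definition is_primitive_idempotent e :=
  is_idempotent e /\
  forall f, is_idempotent f -> op e f = f -> op f e = f -> f = e.

Definition completely_simple :=
  (forall J, is_semigroup_ideal J -> J = setT) /\
  exists e, is_primitive_idempotent e.

End OperationOnSets.

Section LeftSemiBraces.
Variable B : leftSemiBraceType.
Implicit Types (a b : B) (I : set B).

Definition completely_simple_lsb := completely_simple (@sdot B).

Definition oneB : set B := [set 1 · b | b in setT].
Definition Bone : set B := [set b · 1 | b in setT].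
Definition oneBone : set B := [set 1 · b · 1 | b in setT].

Definition lambda_map a b : B := a * (a^-1 · b).
Definition rho_map a b : B := (b^-1 · a)^-1 * a.

Definition rho_antihom :=
  forall a b, rho_map (a * b) = rho_map b \o rho_map a.

Definition is_lsb_ideal I :=
  is_subsemigroup (@sdot B) I /\
  [/\ is_normal_subgroup (@sdot B) (I `&` oneBone) oneBone,
      is_normal_subgroup (@mul B) I setT,
      forall b, oneB b -> rho_map b @` I `<=` I
    & forall a, Bone a -> lambda_map a @` I `<=` I].

End LeftSemiBraces.

Section Homomorphisms.
Variables (B B1 : leftSemiBraceType) (f : B -> B1).

Definition is_lsb_hom :=
  (forall a b, f (a · b) = f a · f b) /\ (forall a b, f (a * b) = f a * f b).

Definition lsb_ker : set B := [set a | f a = 1].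

End Homomorphisms.

(* Main.v *)
Require Import Defs.
From HB Require Import structures.
From mathcomp Require Import all_boot.
From mathcomp Require Import boolp classical_sets.

(** The kernel [I] of a homomorphism [f] is an ideal because [1 · 1 = 1] and
    [1 · B · 1] is a group for the semigroup operation, both consequences of
    complete simplicity, and because [lambda_a] fixes [1] for [a] in [B · 1]:
    each condition on [I] follows by evaluating [f].

    Conversely, an ideal [I] is a normal subgroup of the group of [B], and the
    projection onto its cosets is the wanted homomorphism as soon as the
    relation [a ~ b] of being in the same coset is compatible with the
    semigroup operation.  The anti-homomorphism hypothesis on [rho] unfolds to
    [x · (a * b) = x · a · lambda_a b] ([rho_antihom_sdotM]).  With [b] in [I]
    it reduces the compatibility on the right, [x · a ~ x · (a * i)], to
    [y · lambda_a 1 ~ y · lambda_a i]; since [lambda] is multiplicative and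
    [y · z = y * lambda_{y^-1} z], this reduces to
    [lambda_c 1 ~ lambda_c i], and then to [x · 1 ~ x · i], which is the
    stability of [I] under [lambda_a] for [a] in the subgroup [B · 1]
    ([coset_eq_sdot_ideal]).
    For the compatibility on the left, [lambda_i] can be moved across the
    product: [(i * a) · b = i * (a · lambda_{i^-1} b)].  By the compatibility
    on the right it is enough that [lambda_{i^-1} b ~ 1 · b], which follows
    from the stability of [I] under [rho_c] for [c] in [1 · B]
    ([coset_eq_lambda_ideal]). *)

Local Open Scope group_scope.
Local Open Scope classical_set_scope.

(** * Completely simple semigroups *)

Section CompletelySimple.
Variables (T : Type) (op : T -> T -> T).
Hypothesis opA : associative op.

Local Notation "x ∙ y" := (op x y) (at level 40, left associativity).

Lemma simple_factorization (a b : T) :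
    (forall J, is_semigroup_ideal op J -> J = setT) ->
  exists x y, b = x ∙ a ∙ y.
Proof.
move=> simp; pose J : set T := [set b | exists x y, b = x ∙ a ∙ y].
suff JT : J = setT by have : J b by rewrite JT.
apply: simp; split; first by exists (a ∙ a ∙ a), a, a.
move=> z _ [x [y ->]]; split; first by exists (z ∙ x), y; rewrite !opA.
by exists x, (y ∙ z); rewrite !opA.
Qed.

(** If [e = x a y] with [x], [y] in [e T e], then [a (y x)] and [(y x) a] are
    idempotents below [e], so both equal [e]. *)
Lemma primitive_idempotent_inv (e a : T) :
    (forall J, is_semigroup_ideal op J -> J = setT) ->
    is_primitive_idempotent op e -> e ∙ a = a -> a ∙ e = a ->
  exists b, [/\ e ∙ b = b, b ∙ e = b, a ∙ b = e & b ∙ a = e].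
Proof.
move=> simp [ee prim] ea ae; rewrite /is_idempotent in ee.
have [x [y [uav eu ue ev ve]]] : exists u v,
    [/\ u ∙ a ∙ v = e, e ∙ u = u, u ∙ e = u, e ∙ v = v & v ∙ e = v].
  have [x [y xay]] := simple_factorization a e simp.
  exists (e ∙ x ∙ e), (e ∙ y ∙ e); split; rewrite ?opA ?ee //.
  - rewrite -(opA (e ∙ x)) ea -(opA (e ∙ x)) ae.
    by rewrite -(opA e) -(opA e) -xay !ee.
  - by rewrite -opA ee.
  - by rewrite -opA ee.
exists (y ∙ x); split.
- by rewrite opA ev.
- by rewrite -opA ue.
- apply: prim; rewrite /is_idempotent ?opA ?ea -?[_ ∙ x ∙ e]opA ?ue //.
  by rewrite -(opA _ x a) -(opA _ (x ∙ a)) uav -(opA a) ve.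
- apply: prim; rewrite /is_idempotent ?opA ?ev -?[_ ∙ a ∙ e]opA ?ae //.
  by rewrite -(opA y x) -(opA y _ y) uav ve opA.
Qed.

(** Factor [c] as [x e y] with [e] a primitive idempotent and replace [x], [y]
    by [x e], [e y]; then [c^3 = c^2] gives [q^4 = q^3] for [q = y x], an
    element of the group [e T e], so that [q = e]. *)
Lemma factor_through_primitive (c : T) :
    completely_simple op -> c ∙ c ∙ c = c ∙ c ->
  exists e x y, [/\ is_primitive_idempotent op e, c = x ∙ y, y ∙ x = e,
    x ∙ e = x & e ∙ y = y].
Proof.
move=> [simp [e eprim]] ccc; have ee : e ∙ e = e := eprim.1.
have [x [y [cE xe ey]]] : exists x y, [/\ c = x ∙ y, x ∙ e = x & e ∙ y = y].
  have [x [y cE]] := simple_factorization e c simp.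
  exists (x ∙ e), (e ∙ y); rewrite !opA -(opA x) ee; split=> //.
exists e, x, y; split=> //.
have eq : e ∙ (y ∙ x) = y ∙ x by rewrite opA ey.
have qe : y ∙ x ∙ e = y ∙ x by rewrite -opA xe.
have [g [_ _ _ gq]] := primitive_idempotent_inv e _ simp eprim eq qe.
have can z : e ∙ z = z -> g ∙ (y ∙ x ∙ z) = z by move=> ez; rewrite opA gq.
have q4 : y ∙ x ∙ (y ∙ x ∙ (y ∙ x ∙ (y ∙ x))) = y ∙ x ∙ (y ∙ x ∙ (y ∙ x)).
  by have := congr1 (fun z => y ∙ z ∙ x) ccc; rewrite cE !opA.
have eqz z : e ∙ (y ∙ x ∙ z) = y ∙ x ∙ z by rewrite opA eq.
move/(congr1 (op g)): q4; rewrite !can // => /(congr1 (op g)).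
by rewrite !can // => /(congr1 (op g)); rewrite can // gq.
Qed.

Lemma completely_simple_idempotent (c : T) :
  completely_simple op -> c ∙ c ∙ c = c ∙ c -> is_idempotent op c.
Proof.
move=> cs /(factor_through_primitive _ cs)[e [x [y [_ -> yx xe ey]]]].
by rewrite /is_idempotent opA -(opA x) yx xe.
Qed.

(** With [c = x y] and [y x = e], the map [f |-> y f x] carries the
    idempotents below [c] to idempotents below [e], with inverse
    [f |-> x f y]. *)
Lemma completely_simple_primitive (c : T) :
  completely_simple op -> is_idempotent op c -> is_primitive_idempotent op c.
Proof.
move=> cs cc; split=> // f ff cf fc; rewrite /is_idempotent in cc ff.
have [|e [x [y [[_ prim] cE yx xe ey]]]] := factor_through_primitive c cs.
  by rewrite !cc.
have yfx : y ∙ f ∙ x = e.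
  apply: prim; last 2 first.
  - by rewrite !opA ey.
  - by rewrite -opA xe.
  by rewrite /is_idempotent !opA -(opA _ x y) -cE -(opA _ f c) fc -(opA y) ff.
by rewrite -fc -cf cE !opA -(opA x) -(opA x) yfx xe.
Qed.

(** Every idempotent being primitive, the inverses of the elements of [c T c]
    come from [primitive_idempotent_inv]. *)
Lemma completely_simple_group (c : T) :
    completely_simple op -> is_idempotent op c ->
  is_group op [set c ∙ b ∙ c | b in setT].
Proof.
move=> cs cc; have [simp _] := cs; have cp := completely_simple_primitive c cs cc.
rewrite /is_idempotent in cc.
have cl b : (c ∙ (c ∙ b ∙ c) = c ∙ b ∙ c) * (c ∙ b ∙ c ∙ c = c ∙ b ∙ c).
  by rewrite !opA cc -(opA (c ∙ b)) cc.
split=> [x y [a _ <-] [b _ <-]|x y z _ _ _|]; first 2 last.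
- exists c.
    split=> [|x [b _ <-]]; last by rewrite !cl.
    by exists c => //; rewrite !cc.
  move=> x [a _ <-].
  have [b [cb bc ab ba]] := primitive_idempotent_inv c _ simp cp (cl a).1 (cl a).2.
  by exists b => //; exists b; rewrite // cb bc.
- by exists (a ∙ c ∙ c ∙ b) => //; rewrite !opA.
- exact: opA.
Qed.

End CompletelySimple.

(** * The lambda-action *)

Section LambdaMap.
Variable B : leftSemiBraceType.
Implicit Types a b c x y : B.

Lemma sdot_mid1 b c : b · 1 · c = b · c.
Proof. by rewrite -sdotA -[RHS]mul1g mulg_sdot mul1g invg1 mul1g. Qed.

Lemma sdot1_cubed : (1 : B) · 1 · 1 = 1 · 1.
Proof. exact: sdot_mid1. Qed.

Lemma lambda1 b : lambda_map 1 b = 1 · b.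
Proof. by rewrite /lambda_map mul1g invg1. Qed.

Lemma mulg_sdot_lambda a b c : a * (b · c) = (a * b) · lambda_map a c.
Proof. exact: mulg_sdot. Qed.

Lemma sdot_lambda a b : a · b = a * lambda_map a^-1 b.
Proof. by rewrite /lambda_map mulVKg invgK. Qed.

Lemma lambdaM a b c : lambda_map (a * b) c = lambda_map a (lambda_map b c).
Proof.
rewrite [LHS]/lambda_map invgM -mulgA (mulg_sdot_lambda b).
by rewrite mulVKg.
Qed.

Hypothesis B_cs : completely_simple_lsb B.

Lemma sdot11 : (1 : B) · 1 = 1.
Proof. exact: (completely_simple_idempotent _ _ (@sdotA B) _ B_cs sdot1_cubed). Qed.

Lemma BoneP a : Bone a <-> a · 1 = a.
Proof.
split=> [[b _ <-]|<-]; last by exists a.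
by rewrite -sdotA sdot11.
Qed.

Lemma oneBP a : oneB a <-> 1 · a = a.
Proof.
split=> [[b _ <-]|<-]; last by exists a.
by rewrite sdotA sdot11.
Qed.

(** [1 = a^-1 * (a · 1) = 1 · lambda_{a^-1} 1 = lambda_{a^-1} 1], and
    [lambda_a 1 = lambda_a (lambda_{a^-1} 1) = 1 · 1]. *)
Lemma lambda_Bone a : Bone a -> lambda_map a 1 = 1.
Proof.
move=> /BoneP a1.
have aV1 : lambda_map a^-1 1 = 1.
  have := mulg_sdot_lambda a^-1 a 1; rewrite a1 mulVg -lambda1 -lambdaM.
  by rewrite mul1g.
by rewrite -{1}aV1 -lambdaM mulgV lambda1 sdot11.
Qed.

Lemma Bone_inv a : Bone a -> Bone a^-1.
Proof.
move=> /lambda_Bone /(congr1 (mul a^-1)).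
by rewrite /lambda_map mulKg mulg1 => /BoneP.
Qed.

Lemma rho_antihom_sdotM :
  rho_antihom B -> forall x a b, x · (a * b) = x · a · lambda_map a b.
Proof.
move=> B_rho x a b.
have /(congr1 (fun f => f x^-1)) := B_rho a b.
rewrite /rho_map /= invgM !invgK mulgA => /mulIg.
move=> /(congr1 (fun z => a * z^-1)).
by rewrite invgM !invgK mulVKg mulg_sdot_lambda mulVKg.
Qed.

End LambdaMap.

Arguments BoneP {B}.
Arguments oneBP {B}.

(** * Kernels are ideals *)

Section Kernel.
Variables (B B1 : leftSemiBraceType) (f : B -> B1).
Hypotheses (B_cs : completely_simple_lsb B) (f_hom : is_lsb_hom f).

Let fD : forall a b, f (a · b) = f a · f b := f_hom.1.
Let fM : forall a b, f (a * b) = f a * f b := f_hom.2.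

Lemma lsb_hom1 : f 1 = 1.
Proof. by apply: (@mulgI _ (f 1)); rewrite -fM !mulg1. Qed.

Lemma lsb_homV a : f a^-1 = (f a)^-1.
Proof. by apply: (@mulgI _ (f a)); rewrite -fM !mulgV lsb_hom1. Qed.

Lemma lsb_ker_ideal : is_lsb_ideal (lsb_ker f).
Proof.
have f1 := lsb_hom1; have f11 : (1 : B1) · 1 = 1 by rewrite -f1 -fD sdot11.
have sub11 := sdot11 B B_cs.
have kD : closed_under_op (@sdot B) (lsb_ker f).
  by move=> x y fx fy; rewrite /lsb_ker /= fD fx fy.
have G_group : is_group (@sdot B) (@oneBone B).
  by apply: completely_simple_group sub11 => //; exact: sdotA.
have G1 : oneBone (1 : B) by exists 1 => //; rewrite !sub11.
have Gid (g : B) : oneBone g -> 1 · g = g /\ g · 1 = g.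
  by move=> [b _ <-]; split; rewrite ?sdotA ?sub11 // -sdotA sub11.
have uniq1 e : is_identity_of (@sdot B) (@oneBone B) e -> e = 1.
  by move=> [Ge /(_ _ G1)[e1 _]]; rewrite -e1 (Gid e Ge).2.
split; first by split=> //; exists 1.
split.
- have [GD GA [e eid Ginv]] := G_group.
  split=> //.
  + split=> [x y [kx Gx] [ky Gy]|x y z _ _ _|]; first by split; auto.
      exact: sdotA.
    exists 1; first by split=> [//|x [_ /Gid]].
    move=> x [kx Gx]; have [y Gy [xy yx]] := Ginv _ Gx.
    rewrite (uniq1 e eid) in xy yx; exists y => //; split=> //.
    by rewrite /lsb_ker /= -(Gid _ Gy).1 fD f1 -kx -fD xy f1 kx.
  + move=> e' g h n /uniq1 -> Gg Gh gh hg [kn Gn]; split; last by auto.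
    by rewrite /lsb_ker /= !fD kn -f1 -!fD (Gid _ Gg).2 gh.
- have T_group : is_group (@mul B) setT.
    split=> [//|x y z _ _ _|]; first exact: mulgA.
    exists 1; first by split=> // x _; rewrite mul1g mulg1.
    by move=> x _; exists x^-1 => //; rewrite mulgV mulVg.
  split=> //.
    split=> [x y kx ky|x y z _ _ _|]; last 1 first.
    + exists 1; first by split=> // x _; rewrite mul1g mulg1.
      move=> x kx; exists x^-1; last by rewrite mulgV mulVg.
      by rewrite /lsb_ker /= lsb_homV kx invg1.
    + by rewrite /lsb_ker /= fM kx ky mulg1.
    + exact: mulgA.
  move=> e g h n [_ /(_ 1 I)[]]; rewrite mulg1 => -> _ _ _ gh _ kn.
  by rewrite /lsb_ker /= !fM kn mulg1 -fM gh.
- move=> b /(oneBP B_cs) b1 _ [x kx <-].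
  rewrite /lsb_ker /= /rho_map fM lsb_homV fD lsb_homV kx invg1.
  by rewrite -f1 -fD b1 mulVg f1.
- move=> a aB _ [x kx <-].
  rewrite /lsb_ker /= /lambda_map fM fD kx -f1 -fD -fM.
  by rewrite -[_ * _]/(lambda_map a 1) lambda_Bone.
Qed.

End Kernel.

(** * Cosets of an ideal *)

Section CosetCongruence.
Variables (B : leftSemiBraceType) (I : set B).
Hypotheses (B_cs : completely_simple_lsb B) (B_rho : rho_antihom B).
Hypothesis I_ideal : is_lsb_ideal I.
Implicit Types a b c x y : B.

Lemma lsb_ideal1 : I 1.
Proof.
have [_ [_ [_ _ [_ _ [e [Ie eid] _]] _] _ _]] := I_ideal.
have [ee _] := eid _ Ie.
by have -> : 1 = e by apply: (@mulgI _ e); rewrite mulg1 ee.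
Qed.

Lemma lsb_idealM x y : I x -> I y -> I (x * y).
Proof. by have [_ [_ [_ _ [IM _ _] _] _ _]] := I_ideal; exact: IM. Qed.

Lemma lsb_idealV x : I x -> I x^-1.
Proof.
have [_ [_ [_ _ [_ _ [e [Ie eid] inv]] _] _ _]] := I_ideal => Ix.
have e1 : e = 1 by apply: (@mulgI _ e); rewrite mulg1; case: (eid _ Ie).
have [y Iy [xy _]] := inv _ Ix.
by have -> : x^-1 = y by apply: (@mulgI _ x); rewrite mulgV xy e1.
Qed.

Lemma lsb_idealJ g x : I x -> I (g * x * g^-1).
Proof.
have [_ [_ [_ _ _ nI] _ _]] := I_ideal.
apply: (nI 1) => //; rewrite ?mulgV ?mulVg //.
by split=> // y _; rewrite mul1g mulg1.
Qed.

Lemma lsb_ideal_rho b x : 1 · b = b -> I x -> I (rho_map b x).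
Proof.
by have [_ [_ _ h _]] := I_ideal => /(oneBP B_cs) bB Ix; apply: (h b bB); exists x.
Qed.

Lemma lsb_ideal_lambda a x : Bone a -> I x -> I (lambda_map a x).
Proof. by have [_ [_ _ _ h]] := I_ideal => aB Ix; apply: (h a aB); exists x. Qed.

Definition coset_eq a b := I (a^-1 * b).
Local Notation "a ~ b" := (coset_eq a b) (at level 70).

Lemma coset_eq_refl a : a ~ a.
Proof. by rewrite /coset_eq mulVg; exact: lsb_ideal1. Qed.

Lemma coset_eq_sym a b : a ~ b -> b ~ a.
Proof. by move=> /lsb_idealV; rewrite invgM invgK. Qed.

Lemma coset_eq_trans b a c : a ~ b -> b ~ c -> a ~ c.
Proof.
by move=> ab bc; have := lsb_idealM _ _ ab bc; rewrite -mulgA mulVKg.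
Qed.

Lemma coset_eqMr a i : I i -> a ~ a * i.
Proof. by rewrite /coset_eq mulKg. Qed.

Lemma coset_eqMl i a : I i -> a ~ i * a.
Proof.
by move=> /(lsb_idealJ a^-1); rewrite /coset_eq invgK mulgA.
Qed.

Lemma coset_eq_mul2l a b c : b ~ c -> a * b ~ a * c.
Proof. by rewrite /coset_eq invgM -mulgA mulKg. Qed.

Lemma coset_eq_mul2r a b c : b ~ c -> b * a ~ c * a.
Proof.
move=> /(lsb_idealJ a^-1); rewrite /coset_eq invgM invgK.
by rewrite !mulgA.
Qed.

(** [x · i = (x · 1) · i], and for [y] in [B · 1] the quotient of [y · i] by
    [y] is [lambda_{y^-1} i]. *)
Lemma coset_eq_sdot_ideal x i : I i -> x · 1 ~ x · i.
Proof.
move=> Ii; rewrite -(sdot_mid1 _ x i) (sdot_lambda _ (x · 1) i).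
apply/coset_eqMr/lsb_ideal_lambda => //; apply/Bone_inv => //.
by exists x.
Qed.

Lemma coset_eq_lambda b i : I i -> lambda_map b 1 ~ lambda_map b i.
Proof. by move=> Ii; exact/coset_eq_mul2l/coset_eq_sdot_ideal. Qed.

Lemma coset_eq_sdot_lambda y b i :
  I i -> y · lambda_map b 1 ~ y · lambda_map b i.
Proof.
move=> Ii; rewrite !(sdot_lambda _ y) -!lambdaM.
exact/coset_eq_mul2l/coset_eq_lambda.
Qed.

Lemma coset_eq_sdot2l a b c : b ~ c -> a · b ~ a · c.
Proof.
move=> bc; rewrite -(mulVKg b c) -{1}(mulg1 b).
rewrite (rho_antihom_sdotM _ B_rho a b 1) (rho_antihom_sdotM _ B_rho a b).
exact: coset_eq_sdot_lambda.
Qed.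

(** For [b] in [1 · B] the quotient of [b] by [i · b] is [rho_b (i^-1)]. *)
Lemma coset_eq_ideal_sdot i b : I i -> i · b ~ 1 · b.
Proof.
move=> Ii; rewrite -(sdot_mid1 _ i b) -sdotA.
rewrite -[X in X · _]invgK; apply/lsb_ideal_rho; last exact: lsb_idealV.
by rewrite sdotA sdot11.
Qed.

Lemma coset_eq_lambda_ideal i b : I i -> lambda_map i b ~ 1 · b.
Proof.
move=> Ii; apply: (coset_eq_trans (i^-1 · b)).
  by apply/coset_eq_sym/coset_eqMl.
exact/coset_eq_ideal_sdot/lsb_idealV.
Qed.

Lemma coset_eq_sdot2r a b c : a ~ c -> a · b ~ c · b.
Proof.
(* Normality lets [c] be written as [i * a] rather than [a * i]. *)
move=> /(lsb_idealJ a); rewrite mulVKg; set i := c * a^-1 => Ii.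
have -> : c = i * a by rewrite mulgVK.
have -> : (i * a) · b = i * (a · lambda_map i^-1 b).
  by rewrite mulg_sdot_lambda -lambdaM mulgV lambda1 sdotA sdot_mid1.
apply: coset_eq_trans (coset_eqMl _ _ Ii).
rewrite -{1}(sdot_mid1 _ a b) -sdotA; apply/coset_eq_sdot2l/coset_eq_sym.
exact/coset_eq_lambda_ideal/lsb_idealV.
Qed.

End CosetCongruence.

(** * Quotients *)

Record lsb_congruence (B : leftSemiBraceType) := LsbCongruence {
  congr_rel : equiv_rel B;
  congr_mul : forall a b c d,
    congr_rel a c -> congr_rel b d -> congr_rel (a * b) (c * d);
  congr_sdot : forall a b c d,
    congr_rel a c -> congr_rel b d -> congr_rel (a · b) (c · d)
}.

Section Quotient.
Variables (B : leftSemiBraceType) (R : lsb_congruence B).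

Definition lsb_quotient := {eq_quot (congr_rel B R)}%qT.
HB.instance Definition _ := EqQuotient.on lsb_quotient.
HB.instance Definition _ := Choice.on lsb_quotient.

Definition lsb_proj (a : B) : lsb_quotient := \pi_lsb_quotient%qT a.

Lemma lsb_projP a b : reflect (lsb_proj a = lsb_proj b) (congr_rel B R a b).
Proof. exact: (@eqquotP _ _ lsb_quotient). Qed.

Let lift2 (op : B -> B -> B) (x y : lsb_quotient) :=
  lsb_proj (op (repr x) (repr y)).

Let projK x : lsb_proj (repr x) = x.
Proof. exact: reprK. Qed.

Let repr_proj a : congr_rel B R (repr (lsb_proj a)) a.
Proof. by apply/lsb_projP; rewrite projK. Qed.

Let quot_mul := lift2 mul.
Let quot_sdot := lift2 (@sdot B).
Let quot_inv (x : lsb_quotient) := lsb_proj (repr x)^-1.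

Let projM a b : quot_mul (lsb_proj a) (lsb_proj b) = lsb_proj (a * b).
Proof. by apply/lsb_projP/congr_mul; exact: repr_proj. Qed.

Let projD a b : quot_sdot (lsb_proj a) (lsb_proj b) = lsb_proj (a · b).
Proof. by apply/lsb_projP/congr_sdot; exact: repr_proj. Qed.

Let quot_mulA : associative quot_mul.
Proof.
by move=> x y z; rewrite -(projK x) -(projK y) -(projK z) !projM mulgA.
Qed.
Let quot_mul1 : left_id (lsb_proj 1) quot_mul.
Proof. by move=> x; rewrite -(projK x) projM mul1g. Qed.
Let quot_mulr1 : right_id (lsb_proj 1) quot_mul.
Proof. by move=> x; rewrite -(projK x) projM mulg1. Qed.
Let quot_mulV : left_inverse (lsb_proj 1) quot_inv quot_mul.
Proof. by move=> x; rewrite -{2}(projK x) projM mulVg. Qed.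
Let quot_mulrV : right_inverse (lsb_proj 1) quot_inv quot_mul.
Proof. by move=> x; rewrite -{1}(projK x) projM mulgV. Qed.

HB.instance Definition _ :=
  isGroup.Build lsb_quotient quot_mulA quot_mul1 quot_mulr1 quot_mulV quot_mulrV.

Lemma lsb_projM a b : lsb_proj (a * b) = lsb_proj a * lsb_proj b.
Proof. by rewrite -projM. Qed.

Lemma lsb_projV a : lsb_proj a^-1 = (lsb_proj a)^-1.
Proof.
by apply: (@mulgI _ (lsb_proj a)); rewrite -lsb_projM !mulgV.
Qed.

Let quot_sdotA : associative quot_sdot.
Proof.
by move=> x y z; rewrite -(projK x) -(projK y) -(projK z) !projD sdotA.
Qed.

Let quot_mul_sdot (x y z : lsb_quotient) :
  x * quot_sdot y z = quot_sdot (x * y) (x * quot_sdot x^-1 z).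
Proof.
rewrite -(projK x) -(projK y) -(projK z) -lsb_projV.
by rewrite !(projD, =^~ lsb_projM) mulg_sdot.
Qed.

HB.instance Definition _ :=
  Group_isLeftSemiBrace.Build lsb_quotient quot_sdotA quot_mul_sdot.

Lemma lsb_proj_hom : is_lsb_hom lsb_proj.
Proof. by split=> a b; [rewrite -projD | exact: lsb_projM]. Qed.

End Quotient.

Section CosetQuotient.
Variables (B : leftSemiBraceType) (I : set B).
Hypotheses (B_cs : completely_simple_lsb B) (B_rho : rho_antihom B).
Hypothesis I_ideal : is_lsb_ideal I.

Let coset_eqb a b := `[< coset_eq B I a b >].

Let coset_eqb_refl : reflexive coset_eqb.
Proof. by move=> a; apply/asboolP; exact: coset_eq_refl. Qed.

Let coset_eqb_sym : symmetric coset_eqb.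
Proof. by move=> a b; apply/asboolP/asboolP; exact: coset_eq_sym. Qed.

Let coset_eqb_trans : transitive coset_eqb.
Proof.
move=> b a c /asboolP ab /asboolP bc; apply/asboolP.
exact: coset_eq_trans ab bc.
Qed.

Definition coset_congruence : lsb_congruence B.
Proof.
exists (EquivRel coset_eqb coset_eqb_refl coset_eqb_sym coset_eqb_trans).
- move=> a b c d /asboolP ac /asboolP bd; apply/asboolP.
  apply: (coset_eq_trans _ _ I_ideal (c * b)).
    exact: coset_eq_mul2r.
  exact: coset_eq_mul2l.
- move=> a b c d /asboolP ac /asboolP bd; apply/asboolP.
  apply: (coset_eq_trans _ _ I_ideal (c · b)).
    exact: coset_eq_sdot2r.
  exact: coset_eq_sdot2l.
Defined.

Lemma coset_proj_ker : I = lsb_ker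
 (lsb_proj B coset_congruence).
Proof.
have proj1 : lsb_proj B coset_congruence 1 = 1 by [].
apply/seteqP; split=> a.
  move=> Ia; rewrite /lsb_ker /= -proj1; apply/esym/lsb_projP/asboolP.
  by rewrite /coset_eq invg1 mul1g.
rewrite /lsb_ker /= -proj1 => /esym/lsb_projP/asboolP.
by rewrite /coset_eq invg1 mul1g.
Qed.

End CosetQuotient.

Theorem corollary4p6 (B : leftSemiBraceType)
    (B_cs : completely_simple_lsb B) (B_rho : rho_antihom B) (I : set B) :
  is_lsb_ideal I <->
  exists (B1 : leftSemiBraceType) (f : B -> B1),
    is_lsb_hom f /\ I = lsb_ker f.
Proof.
split=> [I_ideal|[B1 [f [f_hom ->]]]]; last exact: lsb_ker_ideal.
exists (lsb_quotient B (coset_congruence B I B_cs B_rho I_ideal)).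
exists (lsb_proj B _); split; first exact: lsb_proj_hom.
exact: coset_proj_ker.
Qed.
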